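(* Let $G$ be a finite simple graph with vertex set $V=\{v_1,\dots,v_n\}$ and edge set $E$, and let $\psi: V\to 2^{\mathbb{P}}$ be a map with $|\psi(v)|<\infty$ for all $v\in V$. If the $\psi$-graphical arrangement $\mathcal{A}_{G,\psi}$ is supersolvable, then the vertices of $G$ can be ordered (relabeled) as $v_1,v_2,\dots,v_n$ so that: (1) for each $i$ with $1\le i<n$, the neighbors of $v_{i+1}$ among $v_1,\dots,v_i$ form a clique of $G$; and (2) whenever $i<j$ and $v_i$ is adjacent to $v_j$, we have $\psi(v_j)\subseteq\psi(v_i)$. (That is, these conditions, which are sufficient for supersolvability of $\mathcal{A}_{G,\psi}$, are also necessary.)
   Context: $\mathbb{P}$ denotes the set of positive integers and $2^{\mathbb{P}}$ the set of its subsets. The $\psi$-graphical arrangement $\mathcal{A}_{G,\psi}$ is the arrangement of affine hyperplanes in $\mathbb{R}^n$ (coordinates $x_1,\dots,x_n$) consisting of the hyperplanes $x_i=x_j$ for every edge $v_iv_j\in E$, together with $x_i=\alpha$ for every $\alpha\in\psi(v_i)$. Its cone $c(\mathcal{A}_{G,\psi})$ is the central arrangement in $\mathbb{R}^{n+1}$ (coordinates $x_1,\dots,x_n,y$) consisting of the hyperplanes $x_i=x_j$ for $v_iv_j\in E$, the hyperplane $y=0$, and the hyperplanes $x_i=\alpha y$ for $\alpha\in\psi(v_i)$. For a central arrangement $\mathcal{B}$, its intersection lattice $L(\mathcal{B})$ is the set of all nonempty intersections of hyperplanes of $\mathcal{B}$ (including the whole space as the empty intersection), ordered by reverse inclusion;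 it is a geometric lattice with rank function $\mathrm{rk}$. An element $x$ of a geometric lattice $L$ is modular if $\mathrm{rk}(x)+\mathrm{rk}(z)=\mathrm{rk}(x\wedge z)+\mathrm{rk}(x\vee z)$ for all $z\in L$. $L$ is supersolvable if it has a maximal chain $\hat 0=x_0\lessdot x_1\lessdot\cdots\lessdot x_m=\hat 1$ in which every $x_i$ is modular. The arrangement $\mathcal{A}_{G,\psi}$ is called supersolvable if the lattice $L(c(\mathcal{A}_{G,\psi}))$ is supersolvable. *)

(* Defs.v *)
From HB Require Import structures.
From mathcomp Require Import all_boot all_order all_algebra all_fingroup.
From mathcomp Require Import finmap reals.

Set Implicit Arguments.
Unset Strict Implicit.
Unset Printing Implicit Defensive.

Import Order.TTheory GRing.Theory.

Section FiniteLattice.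
Context {d : Order.disp_t} {L : finTBLatticeType d}.
Local Open Scope order_scope.
Implicit Types (x y z : L) (C : {set L}).

Definition is_chain C : bool := [forall x in C, forall y in C, x >=< y].

(* length of the longest chain in the interval [\bot, x] *)
Definition rk x : nat :=
  \max_(C : {set L} | is_chain C && [forall y in C, y <= x]) #|C|.-1.

Definition covers x y : bool :=
  (x < y) && [forall z, ~~ ((x < z) && (z < y))].

Definition modular x : Prop :=
  forall z, (rk x + rk z = rk (x `&` z) + rk (x `|` z))%N.

End FiniteLattice.

Definition supersolvable {d : Order.disp_t} (L : finTBLatticeType d) : Prop :=
  exists s : seq L,
    [/\ path covers \bot%O s, last \bot%O s = \top%O
      & forall x, x \in \bot%O :: s -> modular x].

Section IntersectionLattice.
Context {K : fieldType} {vT : vectType K}.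
Variable B : seq {vspace vT}.
Local Open Scope vspace_scope.

Definition flat_of (J : {set 'I_(size B)}) : {vspace vT} :=
  \bigcap_(i in J) tnth (in_tuple B) i.

(* Hyperplanes of B are linear, so every intersection is nonempty. *)
Definition intersections : seq {vspace vT} :=
  [seq flat_of J | J : {set 'I_(size B)}].

Definition flat : Type := seq_sub intersections.

HB.instance Definition _ := Finite.on flat.
HB.instance Definition _ := SubType.on flat.

Lemma flat_ofP (J : {set 'I_(size B)}) : flat_of J \in intersections.
Proof. exact: codom_f. Qed.

Definition mkflat (J : {set 'I_(size B)}) : flat := SeqSub (flat_ofP J).

Definition hyps_above (U : {vspace vT}) : {set 'I_(size B)} :=
  [set i | U <= tnth (in_tuple B) i].

Lemma sub_flat_of U J : (U <= flat_of J) = (J \subset hyps_above U).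
Proof.
apply/subv_bigcapP/subsetP => [h i iS | h i iS].
  by rewrite inE; apply: h.
by have := h i iS; rewrite inE.
Qed.

Lemma sub_hyps_above (J : {set 'I_(size B)}) : J \subset hyps_above (flat_of J).
Proof. by rewrite -sub_flat_of subvv. Qed.

Lemma flat_hyps_above (x : flat) : flat_of (hyps_above (val x)) = val x.
Proof.
case: x => U /= /codomP[J ->]; apply/eqP; rewrite eqEsubv !sub_flat_of subxx.
by rewrite andbT (subset_trans (sub_hyps_above J) (sub_hyps_above _)).
Qed.

(* reverse inclusion *)
Definition flat_le (x y : flat) : bool := val y <= val x.

Fact flat_le_refl : reflexive flat_le.
Proof. by move=> x; apply: subvv. Qed.

Fact flat_le_anti : antisymmetric flat_le.
Proof.
move=> x y /andP[yx xy]; apply: val_inj; apply/eqP.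
by rewrite eqEsubv; apply/andP.
Qed.

Fact flat_le_trans : transitive flat_le.
Proof. by move=> y x z xy yz; apply: subv_trans yz xy. Qed.

Fact flat_display : Order.disp_t. Proof. by []. Qed.

HB.instance Definition _ := Order.Le_isPOrder.Build flat_display flat
  flat_le_refl flat_le_anti flat_le_trans.

Lemma flat_leE (x y : flat) : (x <= y)%O = (val y <= val x).
Proof. by []. Qed.

Definition flat_join (x y : flat) : flat :=
  mkflat (hyps_above (val x) :|: hyps_above (val y)).

Definition flat_meet (x y : flat) : flat :=
  mkflat (hyps_above (val x) :&: hyps_above (val y)).

Fact flat_leUx (x y z : flat) :
  (flat_join x y <= z)%O = (x <= z)%O && (y <= z)%O.
Proof.
rewrite !flat_leE /= sub_flat_of subUset -!sub_flat_of.
by rewrite !flat_hyps_above.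
Qed.

Fact flat_lexI (x y z : flat) :
  (x <= flat_meet y z)%O = (x <= y)%O && (x <= z)%O.
Proof.
rewrite !flat_leE /= -(flat_hyps_above x) !sub_flat_of -subsetI.
set J := (_ :&: _)%SET; suff -> : hyps_above (flat_of J) = J by [].
apply/eqP; rewrite eqEsubset -sub_flat_of subvv andbT subsetI.
have anti U W : U <= W -> hyps_above W \subset hyps_above U.
  by move=> UW; apply/subsetP => i; rewrite !inE; apply: subv_trans.
by rewrite !anti // sub_flat_of ?subsetIl ?subsetIr.
Qed.

HB.instance Definition _ :=
  Order.POrder_isJoinSemilattice.Build flat_display flat flat_leUx.
HB.instance Definition _ :=
  Order.POrder_isMeetSemilattice.Build flat_display flat flat_lexI.

Fact flat_le0x (x : flat) : (mkflat set0 <= x)%O.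
Proof. by rewrite flat_leE /= sub_flat_of sub0set. Qed.

Fact flat_lex1 (x : flat) : (x <= mkflat setT)%O.
Proof.
rewrite flat_leE /= -(flat_hyps_above x) sub_flat_of.
by apply: subset_trans (sub_hyps_above setT); apply: subsetT.
Qed.

HB.instance Definition _ :=
  Order.hasBottom.Build flat_display flat flat_le0x.
HB.instance Definition _ :=
  Order.hasTop.Build flat_display flat flat_lex1.

End IntersectionLattice.

Local Open Scope ring_scope.

(* (a, b) stands for the affine hyperplane {x | x *m a = b} of R^n. *)
Definition affine_arrangement (R : realType) (n : nat) : Type :=
  seq ('cV[R]_n * R).

(* the hyperplane {u | u *m a = 0} *)
Definition hyperplane (R : realType) (n : nat) (a : 'cV[R]_n) :
  {vspace 'rV[R]_n} := lker (linfun (mulmxr a : 'rV[R]_n -> 'rV[R]_1)).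

(* A vector of R^(n+1) is row_mx x y%:M; the list below consists of y = 0 and,
   for each (a, b) in A, of x *m a = b * y. *)
Definition cone (R : realType) (n : nat) (A : affine_arrangement R n) :
  seq {vspace 'rV[R]_(n + 1)} :=
  hyperplane (col_mx 0 1%:M)
    :: [seq hyperplane (col_mx H.1 (- H.2)%:M) | H <- A].

Lemma mem_hyperplane_cone (R : realType) (n : nat) (a : 'cV[R]_n) (b y : R)
    (x : 'rV[R]_n) :
  (row_mx x y%:M \in hyperplane (col_mx a (- b)%:M))
    = ((x *m a) 0 0 == b * y).
Proof.
rewrite memv_ker lfunE /= mul_row_col -scalar_mxM mulrN.
apply/eqP/eqP => [/matrixP /(_ 0 0)|h].
  by rewrite !mxE eqxx mulr1n => /eqP; rewrite subr_eq0 mulrC => /eqP.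
by apply/matrixP => i j; rewrite !ord1 mxE h !mxE eqxx mulr1n mulrC subrr.
Qed.

Definition arrangement_supersolvable (R : realType) (n : nat)
    (A : affine_arrangement R n) : Prop :=
  supersolvable (flat (cone A)).

(* delta_mx i 0 is the i-th coordinate form; an edge is listed in both
   directions, giving the same hyperplane x_i = x_j twice. *)
Definition psi_graphical (R : realType) (n : nat) (e : rel 'I_n)
    (psi : 'I_n -> {fset nat}) : affine_arrangement R n :=
  [seq (delta_mx p.1 0 - delta_mx p.2 0, 0)
     | p <- enum [pred p : 'I_n * 'I_n | e p.1 p.2]]
  ++ flatten [seq [seq (delta_mx i 0, alpha%:R) | alpha <- psi i]
                | i <- enum 'I_n].

(* Adjacency is irreflexive, hence the restriction to distinct vertices. *)
Definition clique (T : finType) (e : rel T) (Q : {set T}) : Prop :=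
  {in Q &, forall u v, u != v -> e u v}.

(* Main.v *)
Require Import Defs.
From mathcomp Require Import all_boot all_order all_algebra all_fingroup.
From mathcomp Require Import finmap reals zify.

(** A modular maximal chain is a flag of subspaces F_0 > F_1 > ... > F_m in which,
    by modularity, any two hyperplanes that contain F_(i+1) but not F_i span a
    pencil with a third hyperplane of the arrangement that contains F_i.  The
    pencils with at least three hyperplanes come from triangles of G, from an
    edge together with a label shared by its ends, and from the labels of one
    vertex.  A minimal dependent set of hyperplanes has at least two members
    entering the flag at the same last step, so applying this to the circuits
    carried by an induced walk from u to w shows that:
    - G is chordal;
    - a label common to nonadjacent u and w occurs at an inner vertex;
    - u and w cannot each have a label missing from the other and from all
      inner vertices.
    Now take a vertex with a minimal label set A and its component C among the
    vertices labelled A.  The last two facts make the border of C a clique, and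
    Dirac's argument finds in C a simplicial vertex of G; it comes last. *)

Import Order.TTheory GRing.Theory Num.Theory.

(** * Modular flags of flats *)

Section Rank.
Set Implicit Arguments.
Unset Strict Implicit.
Context {d : Order.disp_t} {L : finTBLatticeType d}.
Local Open Scope order_scope.
Implicit Types (x y z : L) (C : {set L}).

(** Adjoin [y] to a longest chain below [x]. [x] is adjoined too: the chosen chain may be empty, and
    [#|C|.-1] does not tell the empty set from a singleton. *)
Lemma rk_lt x y : x < y -> (rk x < rk y)%N.
Proof.
move=> xy; rewrite /rk.
have [|C0 /andP[chC0 /forallP leC0] ->] :=
    @eq_bigmax_cond _ [pred C : {set L} | is_chain C && [forall z in C, z <= x]]
      (fun C => #|C|.-1).
  apply/card_gt0P; exists set0; rewrite inE /is_chain.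
  by apply/andP; split; apply/forallP => z; rewrite inE.
have leC z : z \in C0 -> z <= x by move=> zC; have := leC0 z; rewrite zC.
have chC z t : z \in C0 -> t \in C0 -> z >=< t.
  move=> zC tC; have /forallP/(_ z) := chC0; rewrite zC /= => /forallP/(_ t).
  by rewrite tC.
have yN : y \notin x |: C0.
  rewrite !inE negb_or gt_eqF //=; apply/negP => /leC.
  by rewrite lt_geF.
have ltC : (#|C0|.-1 < #|y |: (x |: C0)|.-1)%N.
  rewrite cardsU1 yN /=; case: (posnP #|C0|) => [->|C0_gt0].
    by rewrite (leq_trans _ (subset_leq_card (subsetUl [set x] C0))) ?cards1.
  by rewrite prednK // subset_leq_card ?subsetUr.
apply: leq_trans ltC _.
apply: (@leq_bigmax_cond _ _ (fun C : {set L} => #|C|.-1)).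
have le2 z : z \in x |: C0 -> z <= x.
  by rewrite !inE => /predU1P[->//|/leC].
apply/andP; split.
  apply/forall_inP => z; rewrite in_setU1 => /predU1P[->|zC]; apply/forall_inP => t;
      rewrite in_setU1 => /predU1P[->|tC].
  - exact: comparablexx.
  - by rewrite ge_comparable // (le_trans (le2 _ tC)) ?ltW.
  - by rewrite le_comparable // (le_trans (le2 _ zC)) ?ltW.
  move: zC tC; rewrite !in_setU1 => /predU1P[->|zC] /predU1P[->|tC].
  - exact: comparablexx.
  - by rewrite ge_comparable // leC.
  - by rewrite le_comparable // leC.
  - exact: chC.
apply/forall_inP => z; rewrite in_setU1 => /predU1P[->//|/le2 zx].
exact: le_trans zx (ltW xy).
Qed.

End Rank.

Section Flag.
Set Implicit Arguments.
Unset Strict Implicit.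
Context {K : fieldType} {vT : vectType K}.
Variable B : seq {vspace vT}.
Local Open Scope vspace_scope.

Lemma flat_lt_dim (x y : flat B) : (x < y)%O -> (\dim (val y) < \dim (val x))%N.
Proof.
rewrite lt_neqAle flat_leE => /andP[xy yx].
rewrite ltn_neqAle dimvS // andbT; apply: contra xy => dE.
by apply/eqP/val_inj/eqP; rewrite eq_sym eqEdim yx (eqP dE) leqnn.
Qed.

(** Members of a chain below [x] have distinct dimensions, all at least [\dim (val x)]. *)
Lemma rk_le_codim (x : flat B) : (rk x + \dim (val x) <= \dim {:vT})%N.
Proof.
have dx : (\dim (val x) <= \dim {:vT})%N by rewrite dimvS ?subvf.
suff: (rk x <= \dim {:vT} - \dim (val x))%N.
  by move=> h; rewrite -[leqRHS](subnK dx) leq_add2r.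
apply/bigmax_leqP => C /andP[/forall_inP chC /forall_inP leC].
set D := (\dim {:vT} - _)%N.
suff: (#|C| <= D.+1)%N by case: #|C|.
pose f (y : flat B) : 'I_D.+1 := inord (\dim (val y) - \dim (val x)).
have fE y : y \in C -> f y = (\dim (val y) - \dim (val x))%N :> nat.
  by move=> yC; rewrite inordK // ltnS leq_sub2r // dimvS ?subvf.
rewrite -[leqRHS]card_ord -(@card_in_imset _ _ f) ?max_card // => y z yC zC.
move/(congr1 val); rewrite /= !fE // => dE.
have le1 t : t \in C -> (\dim (val x) <= \dim (val t))%N.
  by move=> tC; apply: dimvS; rewrite -flat_leE leC.
have {}dE : \dim (val y) = \dim (val z).
  by rewrite -(subnK (le1 _ yC)) -(subnK (le1 _ zC)) dE.
have /forall_inP/(_ z zC) := chC y yC.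
by case/comparable_ltgtP=> // /flat_lt_dim; rewrite dE ltnn.
Qed.

Hypothesis codim1 : forall H, H \in B -> (\dim {:vT} <= (\dim H).+1)%N.

(** Some hyperplane contains [y] but not [x]. Its intersection with [x] is a flat strictly above [x]
    and at most [y], hence [y] itself, and cutting by a hyperplane costs at most one dimension. *)
Lemma covers_dim (x y : flat B) :
  covers x y -> (\dim (val x) <= (\dim (val y)).+1)%N.
Proof.
move=> /andP[xy /forallP nob].
have [i yi nxi] : exists2 i, val y <= tnth (in_tuple B) i
                           & ~~ (val x <= tnth (in_tuple B) i).
  have : ~~ (val x <= val y) by rewrite -flat_leE lt_geF.
  rewrite -{1}(flat_hyps_above y) => /subv_bigcapP nle.
  apply/exists_inP; apply: contra_notT nle => /exists_inPn h i.
  by rewrite inE => /h /negbNE.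
set H := tnth _ _ in yi nxi.
have HB : H \in B by rewrite /H mem_tnth.
pose J := i |: hyps_above B (val x).
have subJ : H :&: val x <= flat_of J.
  rewrite sub_flat_of; apply/subsetP => k; rewrite in_setU1 inE.
  case/predU1P=> [->|]; first by rewrite inE capvSl.
  by rewrite !inE; apply: subv_trans; apply: capvSr.
have ltxJ : (x < mkflat J)%O.
  rewrite lt_leAnge !flat_leE /=; apply/andP; split.
    rewrite -[X in _ <= X](flat_hyps_above x) sub_flat_of.
    by rewrite (subset_trans _ (sub_hyps_above _)) ?subsetUr.
  apply: contra nxi => /subv_trans; apply.
  by have /subsetP/(_ i) := sub_hyps_above J; rewrite !inE eqxx; apply.
have lJy : (mkflat J <= y)%O.
  rewrite flat_leE /= sub_flat_of; apply/subsetP => k; rewrite in_setU1.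
  case/predU1P=> [->|]; first by rewrite inE.
  by rewrite !inE; apply: subv_trans; rewrite -flat_leE ltW.
have {lJy} yE : y = mkflat J.
  have := nob (mkflat J); rewrite ltxJ /= => h.
  by apply/eqP; apply: contraNT h => h; rewrite lt_neqAle lJy eq_sym h.
have : (\dim (H :&: val x) <= \dim (val y))%N by rewrite yE dimvS.
have := dimv_sum_cap H (val x); have := codim1 HB.
have : (\dim (H + val x) <= \dim {:vT})%N by rewrite dimvS ?subvf.
by lia.
Qed.

(** The flat [z = a :&: b] has rank at least 2, while the join of [x] and [z] is at most [y] and so
    has rank at most [i.+1]. Modularity leaves positive rank to the meet, so some hyperplane
    contains both [x] and [z]. *)
Lemma modular_line (i : nat) (x y : flat B) (a b : {vspace vT}) :
  modular x -> (i <= rk x)%N -> (\dim {:vT} <= i.+1 + \dim (val y))%N ->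
  (x <= y)%O ->
  a \in B -> b \in B -> ~~ (a <= b) ->
  val y <= a -> val y <= b -> ~~ (val x <= a) -> ~~ (val x <= b) ->
  exists2 c, c \in B & val x <= c /\ a :&: b <= c.
Proof.
move=> modx rkx dimy xy /seq_tnthP[ia aE] /seq_tnthP[ib bE] nab ya yb nxa nxb.
have flat1 k : flat_of [set k] = tnth (in_tuple B) k by rewrite /flat_of big_set1.
have flat2 : flat_of [set ia; ib] = a :&: b.
  apply/eqP; rewrite eqEsubv subv_cap sub_flat_of !(aE, bE).
  apply/andP; split; last first.
    by apply/subsetP=> k; rewrite !inE => /orP[]/eqP->; rewrite ?capvSl ?capvSr.
  by rewrite -!flat1 !sub_flat_of !(subset_trans _ (sub_hyps_above _)) ?subsetUl ?subsetUr.
pose z : flat B := mkflat [set ia; ib].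
have rkz : (2 <= rk z)%N.
  have ltz : (mkflat [set ia] < z)%O.
    by rewrite lt_leAnge !flat_leE /= flat1 flat2 -aE capvSl subv_cap subvv.
  have lta : (\bot < mkflat [set ia] :> flat B)%O.
    rewrite lt0x; apply: contra nxa => /eqP/(congr1 val) /=.
    rewrite flat1 -aE => ->; rewrite /flat_of big_set0; exact: subvf.
  exact: leq_ltn_trans (leq_ltn_trans (leq0n _) (rk_lt lta)) (rk_lt ltz).
have zy : (z <= y)%O by rewrite flat_leE /= flat2 subv_cap ya yb.
have rkj : (rk (x `|` z)%O <= i.+1)%N.
  have h := rk_le_codim (x `|` z)%O.
  have : (x `|` z <= y)%O by rewrite leUx xy.
  rewrite flat_leE => /dimvS h2.
  rewrite -(leq_add2r (\dim (val (x `|` z)%O))) (leq_trans h) //.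
  by rewrite (leq_trans dimy) // leq_add2l.
have rkm : (0 < rk (x `&` z)%O)%N.
  rewrite -(ltn_add2r (rk (x `|` z)%O)) -modx add0n (leq_ltn_trans rkj) //.
  by rewrite -addn1 -addn1 -addnA leq_add.
have : [exists k, k \in (hyps_above B (val x) :&: hyps_above B (val z))%SET].
  apply: contraLR rkm => /existsPn h.
  rewrite -leqNgt leqn0 -leqn0.
  rewrite -(leq_add2r (\dim (val (x `&` z)%O))) (leq_trans (rk_le_codim _)) //.
  have -> : (x `&` z)%O = mkflat ((hyps_above B (val x) :&: hyps_above B (val z))%SET) by [].
  have -> : (hyps_above B (val x) :&: hyps_above B (val z))%SET = set0.
    by apply/setP=> k; rewrite (negbTE (h k)) inE.
  by rewrite /= /flat_of big_set0.
case/existsP=> k; rewrite !inE /= flat2 => /andP[xk zk].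
by exists (tnth (in_tuple B) k); rewrite ?mem_tnth.
Qed.

(** The flag is the modular chain itself. Each cover raises the rank by at least one and lowers the
    dimension by at most one, which gives the two bounds that [modular_line] asks for at every
    step. *)
Lemma supersolvable_flag : supersolvable (flat B) ->
  exists (m : nat) (F : nat -> {vspace vT}),
  [/\ F 0%N = fullv, forall H, H \in B -> F m <= H &
      forall i a b, (i < m)%N -> a \in B -> b \in B -> ~~ (a <= b) ->
        F i.+1 <= a -> F i.+1 <= b -> ~~ (F i <= a) -> ~~ (F i <= b) ->
        exists2 c, c \in B & F i <= c /\ a :&: b <= c].
Proof.
case=> s [ps ls mods].
pose x i := nth \top%O (\bot%O :: s) i.
have cov i : (i < size s)%N -> covers (x i) (x i.+1).
  by move=> lti; have /(pathP \top%O)/(_ i lti) := ps.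
have ltx i : (i < size s)%N -> (x i < x i.+1)%O by move/cov=> /andP[].
have rkx i : (i <= size s)%N -> (i <= rk (x i))%N.
  elim: i => // i IH lti; exact: leq_ltn_trans (IH (ltnW lti)) (rk_lt (ltx _ lti)).
have val0 : val (\bot%O : flat B) = fullv by rewrite /= /flat_of big_set0.
have dimx i : (i <= size s)%N -> (\dim {:vT} <= i + \dim (val (x i)))%N.
  elim: i => [_|i IH lti]; first by rewrite val0.
  apply: leq_trans (IH (ltnW lti)) _.
  by rewrite addSnnS leq_add2l covers_dim // cov.
exists (size s), (fun i => val (x i)); split.
- exact: val0.
- have -> : x (size s) = \top%O by rewrite -ls (last_nth \top%O).
  move=> H /seq_tnthP[k ->] /=.
  have /subsetP/(_ k) := @sub_hyps_above _ _ B setT; by rewrite !inE; apply.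
- move=> i a b lti aB bB nab ya yb; apply: (@modular_line i (x i) (x i.+1)) => //.
  + by apply: mods; rewrite mem_nth // ltnS ltnW.
  + by rewrite rkx // ltnW.
  + exact: dimx.
  + exact/ltW/ltx.
Qed.
End Flag.

(** * Pencils of the cone *)

Section Hyperplanes.
Set Implicit Arguments.
Unset Strict Implicit.
Context {R : realType} {n : nat}.
Local Open Scope ring_scope.
Implicit Types (i j k l s t u w : 'I_n) (a g : nat).

Lemma dim_hyperplane (N : nat) (a : 'cV[R]_N) :
  (\dim {:'rV[R]_N} <= (\dim (hyperplane a)).+1)%N.
Proof.
rewrite /hyperplane; set f := linfun _.
have <- := limg_ker_dim f fullv; rewrite capfv -[leqRHS]addn1 leq_add2l.
by rewrite (leq_trans (dimvS (subvf _))) // dimvf dim_matrix.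
Qed.

(* [HY] is y = 0, [HE i j] is x_i = x_j and [HP i a] is x_i = a y. *)
Inductive hyp := HY | HE of 'I_n & 'I_n | HP of 'I_n & nat.
Implicit Types (h c : hyp).

Definition hsp h : {vspace 'rV[R]_(n + 1)} :=
  match h with
  | HY => hyperplane (col_mx 0 1%:M)
  | HE i j => hyperplane (col_mx (delta_mx i 0 - delta_mx j 0) (- 0)%:M)
  | HP i a => hyperplane (col_mx (delta_mx i 0) (- a%:R)%:M)
  end.

Definition vec (x : 'I_n -> R) (y : R) : 'rV[R]_(n + 1) :=
  row_mx (\row_i x i) y%:M.

Lemma vecE (v : 'rV[R]_(n + 1)) :
  v = vec (fun i => v 0 (lshift 1 i)) (v 0 (rshift n 0)).
Proof.
rewrite -[LHS]hsubmxK /vec; congr row_mx.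
  by apply/rowP => i; rewrite !mxE.
by apply/rowP => i; rewrite !ord1 !mxE mulr1n.
Qed.

Lemma row_mul_delta (x : 'I_n -> R) i :
  ((\row_k x k) *m delta_mx i 0 : 'M_1) 0 0 = x i.
Proof.
rewrite mxE (bigD1 i) //= big1 ?addr0 => [|k ki]; rewrite !mxE !eqxx ?mulr1 //.
by rewrite (negbTE ki) mulr0.
Qed.

Lemma mem_HY x y : (vec x y \in hsp HY) = (y == 0).
Proof.
rewrite /= /hyperplane memv_ker lfunE /= mul_row_col mulmx0 add0r mulmx1.
apply/eqP/eqP => [/matrixP/(_ 0 0)|->]; first by rewrite !mxE mulr1n.
exact: raddf0.
Qed.

Lemma mem_HE x y i j : (vec x y \in hsp (HE i j)) = (x i == x j).
Proof.
rewrite /hsp mem_hyperplane_cone mul0r mulmxBr mxE row_mul_delta.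
by rewrite [X in _ + X]mxE row_mul_delta subr_eq0.
Qed.

Lemma mem_HP x y i a : (vec x y \in hsp (HP i a)) = (x i == a%:R * y).
Proof. by rewrite /hsp mem_hyperplane_cone row_mul_delta. Qed.

Definition mem_hspE := (mem_HY, mem_HE, mem_HP).

Lemma vsub_vecP (U V : {vspace 'rV[R]_(n + 1)}) :
  reflect (forall x y, vec x y \in U -> vec x y \in V) (U <= V)%VS.
Proof.
apply: (iffP subvP) => [h x y|h v]; first exact: h.
by rewrite [v]vecE; apply: h.
Qed.

Variables (e : rel 'I_n) (psi : 'I_n -> {fset nat}).

Definition in_cone h : bool :=
  match h with
  | HY => true
  | HE i j => e i j
  | HP i a => a \in psi i
  end.

Lemma hsp_in_cone h : in_cone h -> hsp h \in cone (psi_graphical R e psi).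
Proof.
rewrite /cone inE; case: h => [|i j|i a] hA; first by rewrite eqxx.
- apply/orP; right; apply/mapP; exists (delta_mx i 0 - delta_mx j 0, 0) => //.
  rewrite mem_cat; apply/orP; left; apply/mapP; exists (i, j) => //.
  by rewrite mem_enum.
- apply/orP; right; apply/mapP; exists (delta_mx i 0, a%:R) => //.
  rewrite mem_cat; apply/orP; right; apply/flattenP.
  exists [seq (delta_mx i 0, b%:R) | b <- psi i]; last by apply/mapP; exists a.
  by apply/mapP; exists i; rewrite ?mem_enum.
Qed.

Lemma cone_hspP (H : {vspace 'rV[R]_(n + 1)}) :
  H \in cone (psi_graphical R e psi) -> exists2 h, in_cone h & H = hsp h.
Proof.
rewrite inE => /predU1P[->|/mapP[/= ab]]; first by exists HY.
rewrite mem_cat => /orP[/mapP[[i j]]|/flattenP[L /mapP[i _ ->] /mapP[a aL]]].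
  by rewrite mem_enum => eij -> ->; exists (HE i j).
by move=> -> ->; exists (HP i a).
Qed.

(** One step of the flag of [supersolvable_flag], in terms of the hyperplanes of the cone; [F'] is
    the member that follows [F]. *)
Definition exchange (F F' : {vspace 'rV[R]_(n + 1)}) : Prop :=
  forall h1 h2, in_cone h1 -> in_cone h2 -> ~~ (hsp h1 <= hsp h2)%VS ->
    (F' <= hsp h1)%VS -> (F' <= hsp h2)%VS ->
    ~~ (F <= hsp h1)%VS -> ~~ (F <= hsp h2)%VS ->
    exists2 c, in_cone c & (F <= hsp c)%VS /\ (hsp h1 :&: hsp h2 <= hsp c)%VS.

Lemma cone_flag : arrangement_supersolvable (psi_graphical R e psi) ->
  exists (m : nat) (F : nat -> {vspace 'rV[R]_(n + 1)}),
  [/\ F 0%N = fullv, forall h, in_cone h -> (F m <= hsp h)%VS &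
      forall i : nat, (i < m)%N -> exchange (F i) (F i.+1)].
Proof.
case/supersolvable_flag.
  by move=> H /cone_hspP[[|i j|i a] _ ->]; apply: dim_hyperplane.
move=> m [F [F0 Fm Fex]]; exists m, F; split=> // [h hA|i im h1 h2 aA bA].
  exact/Fm/hsp_in_cone.
move=> nab aF' bF' aF bF.
have [||H /cone_hspP[c cA ->] hc] := Fex i (hsp h1) (hsp h2) im _ _ nab aF' bF' aF bF.
- exact: hsp_in_cone.
- exact: hsp_in_cone.
by exists c.
Qed.

Lemma hsp_HEC i j : hsp (HE i j) = hsp (HE j i).
Proof.
by apply/eqP; rewrite eqEsubv; apply/andP; split; apply/vsub_vecP=> x y;
  rewrite !mem_hspE eq_sym.
Qed.

Hypothesis (e_sym : symmetric e) (e_irr : irreflexive e).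

Lemma edge_neq i j : e i j -> i != j.
Proof. by apply: contraTneq => ->; rewrite e_irr. Qed.

(** * Third hyperplanes in the pencils of two tied hyperplanes *)

Section Ties.
Variables F F' : {vspace 'rV[R]_(n + 1)}.
Hypothesis FF' : exchange F F'.

(* The two hyperplanes enter the flag at the same step. *)
Definition tie h1 h2 : Prop :=
  [/\ in_cone h1, in_cone h2,
      (F' <= hsp h1)%VS && (F' <= hsp h2)%VS,
      ~~ (F <= hsp h1)%VS & ~~ (F <= hsp h2)%VS].

Lemma tieC h1 h2 : tie h1 h2 -> tie h2 h1.
Proof. by case=> ? ? ? ? ?; split=> //; rewrite andbC. Qed.

(** The point [vec x0 y0] witnesses the non-inclusion that [exchange] requires. *)
Lemma tie_third h1 h2 x0 y0 : tie h1 h2 ->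
  vec x0 y0 \in hsp h1 -> vec x0 y0 \notin hsp h2 ->
  exists2 c, in_cone c & (F <= hsp c)%VS /\
    forall x y, vec x y \in hsp h1 -> vec x y \in hsp h2 -> vec x y \in hsp c.
Proof.
case=> a1 a2 /andP[f1 f2] n1 n2 m1 m2.
have [|c cA [Fc hc]] := FF' a1 a2 _ f1 f2 n1 n2.
  by apply: contra m2 => /vsub_vecP; apply.
exists c => //; split=> // x y xy1 xy2; apply: (subvP hc).
by rewrite memv_cap xy1.
Qed.

(** Test vectors: those satisfying both equations of a tie must satisfy that of the third
    hyperplane, which pins down its vertices. *)
Let ind (Q : pred 'I_n) : 'I_n -> R := fun z => (Q z)%:R.

Let ind_eq (Q : pred 'I_n) k l : (ind Q k == ind Q l) = (Q k == Q l).
Proof. by rewrite /ind eqr_nat; case: (Q k); case: (Q l). Qed.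

Let ind_eq0 (Q : pred 'I_n) k (z : R) : (ind Q k == z * 0) = ~~ Q k.
Proof. by rewrite /ind mulr0; case: (Q k); rewrite ?eqxx ?oner_eq0. Qed.

(** With [L] the vertices of a tie, the indicator of a single vertex outside [L] satisfies both
    equations, so it cannot separate the ends of a third edge. *)
Let ends_in p q (L : seq 'I_n) : p != q ->
  (forall z, z \notin L -> (p == z) = (q == z)) -> p \in L /\ q \in L.
Proof.
move=> pq h; split; apply: contraNT pq => /h.
  by rewrite eqxx eq_sym => <-.
by rewrite eqxx => ->.
Qed.

(** The constant vector 1, with [y = 1] and with [y = 0], leaves only edges as third hyperplane. Its
    ends are among [i], [j], [k], and it is neither tied edge because it contains [F]. *)
Lemma tie_EE_shared i j k : tie (HE i j) (HE j k) -> i != k -> e i k.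
Proof.
move=> T ik; have [ij jk _ n1 n2] := T.
have [||c cA [Fc hc]] := @tie_third _ _ (ind (pred1 k)) 0 T.
- by rewrite mem_hspE ind_eq /= (negbTE ik) (negbTE (edge_neq jk)).
- by rewrite mem_hspE ind_eq /= eqxx (negbTE (edge_neq jk)).
have {hc}hE x y : x i = x j -> x j = x k -> vec x y \in hsp c.
  by move=> h1 h2; apply: hc; rewrite mem_hspE ?h1 ?h2.
case: c cA Fc hE => [|p q|p a] cA Fc hE.
- by have := hE (fun _ => 1) 1 erefl erefl; rewrite mem_hspE oner_eq0.
- have hQ (Q : pred 'I_n) : Q i = Q j -> Q j = Q k -> Q p = Q q.
    move=> h1 h2; apply/eqP; rewrite -ind_eq -(mem_HE _ 0).
    by apply: hE; rewrite /ind ?h1 ?h2.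
  have [||] := @ends_in p q [:: i; j; k]; first exact: edge_neq.
    move=> z; rewrite !inE !negb_or ![z == _]eq_sym => /and3P[zi zj zk].
    by apply: (hQ (pred1 z)); rewrite /= !(negbTE zi, negbTE zj, negbTE zk).
  have pq := edge_neq cA.
  rewrite !inE => /or3P[]/eqP pE /or3P[]/eqP qE; move: pq cA Fc; rewrite pE qE ?eqxx //;
    by rewrite 1?e_sym // ?(negbTE n1) ?(negbTE n2) // hsp_HEC ?(negbTE n1) ?(negbTE n2).
- by have := hE (fun _ => 1) 0 erefl erefl; rewrite mem_hspE mulr0 oner_eq0.
Qed.

(** The indicator of [i] and [j] lies on both edges and excludes any third edge joining one pair to
    the other. *)
Lemma tie_EE_disjoint i j k l : tie (HE i j) (HE k l) ->
  i != k -> i != l -> j != k -> j != l -> False.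
Proof.
move=> T ik il jk jl; have [ij kl _ n1 n2] := T.
have [||c cA [Fc hc]] := @tie_third _ _ (ind (pred1 k)) 0 T.
- by rewrite mem_hspE ind_eq /= (negbTE ik) (negbTE jk).
- by rewrite mem_hspE ind_eq /= eqxx [l == k]eq_sym (negbTE (edge_neq kl)).
have {hc}hE x y : x i = x j -> x k = x l -> vec x y \in hsp c.
  by move=> h1 h2; apply: hc; rewrite mem_hspE ?h1 ?h2.
case: c cA Fc hE => [|p q|p a] cA Fc hE.
- by have := hE (fun _ => 1) 1 erefl erefl; rewrite mem_hspE oner_eq0.
- have hQ (Q : pred 'I_n) : Q i = Q j -> Q k = Q l -> Q p = Q q.
    move=> h1 h2; apply/eqP; rewrite -ind_eq -(mem_HE _ 0).
    by apply: hE; rewrite /ind ?h1 ?h2.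
  have [||] := @ends_in p q [:: i; j; k; l]; first exact: edge_neq.
    move=> z; rewrite !inE !negb_or ![z == _]eq_sym => /and4P[zi zj zk zl].
    by apply: (hQ (pred1 z)); rewrite /= !(negbTE zi, negbTE zj, negbTE zk, negbTE zl).
  have := hQ (pred2 i j); rewrite /= !eqxx orbT ![k == _]eq_sym ![l == _]eq_sym.
  rewrite (negbTE ik) (negbTE il) (negbTE jk) (negbTE jl) => /(_ erefl erefl).
  have pq := edge_neq cA.
  rewrite !inE => hpq /or4P[]/eqP pE /or4P[]/eqP qE; move: pq cA Fc hpq; rewrite pE qE;
    rewrite ?eqxx ?(negbTE n1) ?(negbTE n2) // 1?hsp_HEC ?(negbTE n1) ?(negbTE n2) //;
    rewrite ?[k == _]eq_sym ?[l == _]eq_sym ?orbT;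
    by rewrite ?(negbTE ik) ?(negbTE il) ?(negbTE jk) ?(negbTE jl).
- by have := hE (fun _ => 1) 0 erefl erefl; rewrite mem_hspE mulr0 oner_eq0.
Qed.

Lemma tieEr h i j : tie h (HE i j) -> tie h (HE j i).
Proof. by case=> ? ? ? ? ?; split=> //; rewrite /in_cone 1?e_sym // hsp_HEC. Qed.

Lemma tie_EE x u s t : tie (HE x u) (HE s t) -> x != s -> x != t ->
  (s = u /\ e x t) \/ (t = u /\ e x s).
Proof.
move=> T xs xt; have [su|su] := eqVneq s u.
  by subst s; left; split=> //; apply: tie_EE_shared T xt.
have [tu|tu] := eqVneq t u.
  by subst t; right; split=> //; apply: tie_EE_shared (tieEr T) xs.
by have := tie_EE_disjoint T xs xt; rewrite ![u == _]eq_sym => /(_ su tu).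
Qed.

(** The point with all coordinates [a] and [y = 1] lies on both, so the third hyperplane is not [HY]
    and a label in it must be [a]. Indicators rule out a new edge and leave only the label [a] at
    the other end of an edge through [i]. *)
Lemma tie_PE i a s t : tie (HP i a) (HE s t) ->
  (s = i /\ a \in psi t) \/ (t = i /\ a \in psi s).
Proof.
move=> /tieC T; have [st _ _ n1 n2] := T; have st' := edge_neq st.
have [||c cA [Fc hc]] := @tie_third _ _ (fun _ => 1) 0 T; rewrite ?mem_hspE ?eqxx //.
  by rewrite mulr0 oner_eq0.
have {hc}hE x y : x i = a%:R * y -> x s = x t -> vec x y \in hsp c.
  by move=> h1 h2; apply: hc; rewrite mem_hspE ?h1 ?h2.
case: c cA Fc hE => [|p q|p b] cA Fc hE.
- have := hE (fun _ => a%:R) 1; rewrite mem_hspE oner_eq0 mulr1.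
  by move=> /(_ erefl erefl).
- have hQ (Q : pred 'I_n) : Q i = false -> Q s = Q t -> Q p = Q q.
    move=> h1 h2; apply/eqP; rewrite -ind_eq -(mem_HE _ 0).
    by apply: hE; rewrite /ind ?h1 ?h2 ?mulr0.
  have pq := edge_neq cA.
  have [|] := @ends_in p q [:: i; s; t] pq.
    move=> z; rewrite !inE !negb_or ![z == _]eq_sym => /and3P[zi zs zt].
    by apply: (hQ (pred1 z)); rewrite /= ?(negbTE zi) ?(negbTE zs) ?(negbTE zt).
  have [si|si] := eqVneq s i.
    subst i; rewrite !inE !orbA !orbb => /orP[]/eqP pE /orP[]/eqP qE;
      move: pq cA Fc; rewrite pE qE ?eqxx ?(negbTE n1) //.
    by rewrite hsp_HEC (negbTE n1).
  have [ti|ti] := eqVneq t i.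
    subst i; rewrite !inE => /or3P[]/eqP pE /or3P[]/eqP qE;
      move: pq cA Fc; rewrite pE qE ?eqxx ?(negbTE n1) //;
      by rewrite hsp_HEC (negbTE n1).
  have := hQ (pred2 s t); rewrite /= !eqxx orbT ![i == _]eq_sym.
  rewrite (negbTE si) (negbTE ti) => /(_ erefl erefl) hpq.
  rewrite !inE => /or3P[]/eqP pE /or3P[]/eqP qE; move: pq cA Fc hpq; rewrite pE qE;
    rewrite ?eqxx ?(negbTE n1) // 1?hsp_HEC ?(negbTE n1) // ?orbT;
    by rewrite ![i == _]eq_sym (negbTE si) (negbTE ti).
- have ba : b = a.
    have := hE (fun _ => a%:R) 1; rewrite mem_hspE !mulr1 eqr_nat.
    by move=> /(_ erefl erefl) /eqP.
  subst b; have hQ (Q : pred 'I_n) : Q i = false -> Q s = Q t -> Q p = false.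
    move=> h1 h2; have := hE (fun z => a%:R + ind Q z) 1; rewrite mem_hspE !mulr1.
    rewrite /ind h1 h2 addr0 => /(_ erefl erefl).
    by rewrite -subr_eq0 addrC addKr pnatr_eq0; case: (Q p).
  have pi : p != i by apply: contraNneq n2 => <-.
  have [ps|ps] := eqVneq p s.
    have [ti|ti] := eqVneq t i; first by right; rewrite -ps.
    have := hQ (pred2 s t); rewrite /= !eqxx orbT ![i == _]eq_sym (negbTE ti) -ps.
    by rewrite (negbTE pi) eqxx => /(_ erefl erefl).
  have [pt|pt] := eqVneq p t.
    have [si|si] := eqVneq s i; first by left; rewrite -pt.
    have := hQ (pred2 s t); rewrite /= !eqxx orbT ![i == _]eq_sym (negbTE si) -pt.
    by rewrite (negbTE pi) eqxx orbT => /(_ erefl erefl).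
  have := hQ (pred1 p); rewrite /= eqxx ![_ == p]eq_sym.
  by rewrite (negbTE pi) (negbTE ps) (negbTE pt) => /(_ erefl erefl).
Qed.

(** Only the edge between [i] and [j] can complete this pencil, and it contains the intersection
    only when [a = b]. *)
Lemma tie_PP i a j b : tie (HP i a) (HP j b) -> i != j -> e i j /\ a = b.
Proof.
move=> T ij; have [ai bj _ n1 n2] := T.
have [||c cA [Fc hc]] := @tie_third _ _ (ind (pred1 j)) 0 T.
- by rewrite mem_hspE ind_eq0 /= ij.
- by rewrite mem_hspE ind_eq0 /= eqxx.
have {hc}hE x y : x i = a%:R * y -> x j = b%:R * y -> vec x y \in hsp c.
  by move=> h1 h2; apply: hc; rewrite mem_hspE ?h1 ?h2.
(* The value [w] at the other vertices is free: 0 rules out [HY] and yields [a = b] for a third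
   edge, and [g.+1] rules out a label [g] at a third vertex. *)
have hW (w : nat) :
    vec (fun z => if z == i then a%:R else if z == j then b%:R else w%:R) 1
      \in hsp c.
  by apply: hE; rewrite mulr1 ?eqxx // eq_sym (negbTE ij).
case: c cA Fc hE hW => [|p q|p g] cA Fc hE hW.
- by have := hW 0; rewrite mem_hspE oner_eq0.
- have hQ (Q : pred 'I_n) : Q i = false -> Q j = false -> Q p = Q q.
    move=> h1 h2; apply/eqP; rewrite -ind_eq -(mem_HE _ 0).
    by apply: hE; rewrite /ind ?h1 ?h2 ?mulr0.
  have pq := edge_neq cA.
  have [|] := @ends_in p q [:: i; j] pq.
    move=> z; rewrite !inE !negb_or ![z == _]eq_sym => /andP[zi zj].
    by apply: (hQ (pred1 z)); rewrite /= ?(negbTE zi) ?(negbTE zj).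
  rewrite !inE => /orP[]/eqP pE /orP[]/eqP qE; move: pq cA Fc (hW 0);
    rewrite pE qE ?eqxx // mem_hspE eqxx ?[j == i]eq_sym (negbTE ij) ?eqxx eqr_nat.
    by move=> _ ? _ /eqP.
  by rewrite e_sym => _ ? _ /eqP.
- have := hW g.+1; rewrite mem_hspE mulr1; have [pi|pi] := eqVneq p i.
    by rewrite eqr_nat => /eqP ag; move: Fc; rewrite pi -ag (negbTE n1).
  have [pj|pj] := eqVneq p j.
    by rewrite eqr_nat => /eqP ag; move: Fc; rewrite pj -ag (negbTE n2).
  by rewrite eqr_nat => /eqP h; elim: g h {Fc cA hE hW} => // g IH [].
Qed.

(** The points with [y = 0] and [x s = x t] lie together in no hyperplane of the cone other than
    these two. *)
Lemma tie_YE s t : tie HY (HE s t) -> False.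
Proof.
move=> /tieC T; have [st _ _ n1 n2] := T.
have [||c cA [Fc hc]] := @tie_third _ _ (fun _ => 1) 1 T; rewrite ?mem_hspE ?oner_eq0 //.
have {hc}hE x : x s = x t -> vec x 0 \in hsp c.
  by move=> h1; apply: hc; rewrite mem_hspE ?h1.
case: c cA Fc hE => [|p q|p b] cA Fc hE.
- by rewrite Fc in n2.
- have pq := edge_neq cA.
  have [|] := @ends_in p q [:: s; t] pq.
    move=> z; rewrite !inE !negb_or ![z == _]eq_sym => /andP[zs zt].
    have := hE (ind (pred1 z)); rewrite mem_hspE ind_eq /= => h; apply: (eqP (h _)).
    by rewrite /ind /= (negbTE zs) (negbTE zt).
  rewrite !inE => /orP[]/eqP pE /orP[]/eqP qE; move: pq Fc;
    rewrite pE qE ?eqxx ?(negbTE n1) //.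
  by rewrite hsp_HEC (negbTE n1).
- by have := hE (fun _ => 1) erefl; rewrite mem_hspE mulr0 oner_eq0.
Qed.

(** The rest of this pencil consists of the hyperplanes of the other labels of [i]. *)
Lemma tie_YP i a : tie HY (HP i a) -> exists2 g, g \in psi i & (F <= hsp (HP i g))%VS.
Proof.
move=> /tieC T; have [ai _ _ n1 n2] := T.
have [||c cA [Fc hc]] := @tie_third _ _ (fun _ => a%:R) 1 T;
  rewrite ?mem_hspE ?mulr1 ?oner_eq0 //.
have {hc}hE (Q : pred 'I_n) : Q i = false -> vec (ind Q) 0 \in hsp c.
  by move=> h1; apply: hc; rewrite mem_hspE // ind_eq0 h1.
case: c cA Fc hE => [|p q|p b] cA Fc hE.
- by rewrite Fc in n2.
- have pq := edge_neq cA.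
  have [|] := @ends_in p q [:: i] pq.
    move=> z; rewrite !inE eq_sym => zi; have := hE (pred1 z) (negbTE zi).
    by rewrite mem_hspE ind_eq /= => /eqP.
  by rewrite !inE => /eqP pE /eqP qE; rewrite pE qE eqxx in pq.
- have [pi|pi] := eqVneq p i; first by exists b; rewrite -pi.
  have := hE (pred1 p); rewrite mem_hspE ind_eq0 /= eqxx eq_sym.
  by move=> /(_ (negbTE pi)).
Qed.
End Ties.
End Hyperplanes.

(** * Circuits carried by induced walks *)

Section InducedWalks.
Set Implicit Arguments.
Unset Strict Implicit.
Context {T : eqType} (e : rel T).
Hypothesis e_irr : irreflexive e.

(** Absence of repetitions and chords only; adjacency of consecutive vertices is left to [path]. *)
Fixpoint induced (u : T) (p : seq T) : bool :=
  if p is c :: q then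
    [&& u \notin p, all (fun b => ~~ e u b) q & induced c q]
  else true.

Lemma induced_notin u p : induced u p -> u \notin p.
Proof. by case: p => //= c q /and3P[]. Qed.

(** Lets a walk jump from [u] to its last neighbour on an induced path, after which no chord at [u]
    remains. *)
Lemma last_neighbor u c q : path e c q -> induced c q -> u \notin c :: q ->
  has (e u) (c :: q) ->
  exists b r, [/\ e u b, path e b r, induced b r, all (fun z => ~~ e u z) r
                & {subset b :: r <= c :: q} /\ last b r = last c q].
Proof.
elim: q c => [|d q IH] c.
  by rewrite /= orbF => _ _ _ euc; exists c, [::]; split=> //; split.
move=> pq iq uN hasu; have [hq|hq] := boolP (has (e u) (d :: q)).
  case/andP: pq => ecd pq; case/and3P: iq => _ _ iq.
  have [|b [r [eub pr ir ar [sr lr]]]] := IH d pq iq _ hq.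
    by move: uN; rewrite inE negb_or => /andP[].
  exists b, r; split=> //; split=> // z /sr zq.
  by rewrite inE zq orbT.
exists c, (d :: q); split=> //; last by split.
  by move: hasu; rewrite [has _ _]/= -/(has (e u) (d :: q)) (negbTE hq) orbF.
by rewrite -all_predC in hq.
Qed.

(** Remove repetitions, make the tail induced by induction, then shortcut from [u] to its last
    neighbour on that tail. *)
Lemma induced_walk u p : path e u p -> u != last u p ->
  exists q, [/\ path e u q, induced u q, {subset q <= p} & last u q = last u p].
Proof.
case/shortenP=> q pq uq sq ulast.
suff [r [pr ir sr lr]] : exists r,
    [/\ path e u r, induced u r, {subset r <= q} & last u r = last u q].
  by exists r; split=> // z /sr /sq.
elim: q u pq uq ulast {sq} => [|c q IH] u; first by rewrite eqxx.
move=> /= /andP[euc pq] /andP[uN uq] ulast.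
have [cl|cl] := eqVneq c (last c q).
  exists [:: c]; split=> //=; rewrite ?euc // ?inE ?andbT //.
    by apply: contraTneq euc => ->; rewrite e_irr.
  by move=> z; rewrite !inE => ->.
have [r [pr ir sr lr]] := IH c pq uq cl.
have sub : {subset c :: r <= c :: q}.
  by move=> z; rewrite !inE => /predU1P[->|/sr->]; rewrite ?eqxx ?orbT.
have [||b [r' [eub pr' ir' ar' [sr' lr']]]] := @last_neighbor u c r pr ir.
- by apply: contra uN => /sub.
- by rewrite /= euc.
exists (b :: r'); split=> //=.
- by rewrite eub.
- by rewrite ar' ir' !andbT; apply: contra uN => /sr' /sub.
- by move=> z /sr' /sub.
- by rewrite lr' lr.
Qed.

Lemma path_failing (r : rel T) u p : path e u p -> ~~ path r u p ->
  exists a b, [/\ a \in u :: p, b \in p, e a b & ~~ r a b].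
Proof.
elim: p u => //= c p IH u /andP[euc pp]; have [ruc|ruc] := boolP (r u c).
  move=> /= /(IH c pp)[a [b [ac bp eab rab]]]; exists a, b; split=> //.
    by rewrite inE ac orbT.
  by rewrite inE bp orbT.
by move=> _; exists u, c; rewrite !inE !eqxx.
Qed.

End InducedWalks.

Lemma first_step (P : pred nat) m : ~~ P 0 -> P m ->
  exists j, [/\ (j < m)%N, P j.+1 & ~~ P j].
Proof.
move=> P0; elim: m => [P0'|m IH Pm]; first by rewrite P0' in P0.
have [/IH[j [jm Pj1 Pj]]|nP] := boolP (P m).
  by exists j; split=> //; apply: leq_trans jm _.
by exists m.
Qed.

(** * Configurations of walks and labels that a modular flag forbids *)

Section Obstructions.
Set Implicit Arguments.
Unset Strict Implicit.
Context {R : realType} {n : nat}.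
Variables (e : rel 'I_n) (psi : 'I_n -> {fset nat}).
Hypothesis (e_sym : symmetric e) (e_irr : irreflexive e).
Local Open Scope ring_scope.
Let vT := 'rV[R]_(n + 1).
Implicit Types (F : {vspace vT}) (u w s t c : 'I_n) (p : seq 'I_n) (h : @hyp n).

Definition equal_on F : rel 'I_n := fun s t => (F <= hsp (HE s t))%VS.

Lemma equal_onP F s t :
  reflect (forall x y, vec x y \in F -> x s = x t) (equal_on F s t).
Proof.
apply: (iffP (vsub_vecP _ _)) => h x y /h; first by rewrite mem_HE => /eqP.
by rewrite mem_HE => ->.
Qed.

Lemma equal_on_trans F : transitive (equal_on F).
Proof.
move=> b a c /equal_onP ab /equal_onP bc; apply/equal_onP => x y xF.
by rewrite (ab _ _ xF) (bc _ _ xF).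
Qed.

Lemma equal_on_sym F : symmetric (equal_on F).
Proof. by move=> a b; rewrite /equal_on hsp_HEC. Qed.

Lemma equal_on_last F u p : path (equal_on F) u p -> equal_on F u (last u p).
Proof.
elim: p u => [|c p IH] u /=; first by move=> _; apply/equal_onP.
by move=> /andP[uc /IH]; apply: equal_on_trans.
Qed.

Lemma failing_edge F F' u p : path e u p -> path (equal_on F') u p ->
  ~~ path (equal_on F) u p ->
  exists s t, [/\ s \in u :: p, t \in p, e s t, equal_on F' s t & ~~ equal_on F s t].
Proof.
move=> pe pF' nF.
have pI : path (fun s t => e s t && equal_on F' s t) u p.
  elim: p u pe pF' {nF} => //= c p IH u /andP[-> pe] /andP[-> pF'] /=.
  exact: IH.
have [s [t [su tp /andP[est st] nst]]] := path_failing pI nF.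
by exists s, t.
Qed.

(* On an induced walk no two edges fail at the same step, for their third
   hyperplane would be a chord. *)
Lemma induced_walk_equal F F' u p : exchange e psi F F' ->
  path e u p -> induced e u p -> path (equal_on F') u p ->
  equal_on F u (last u p) -> path (equal_on F) u p.
Proof.
move=> exF; elim: p u => //= c p IH u /andP[euc pe] /and3P[uN achord ip].
move=> /andP[uc' pF'] ul; have [uc|uc] := boolP (equal_on F u c).
  by apply: IH => //; apply: equal_on_trans ul; rewrite equal_on_sym.
have pF : path (equal_on F) c p.
  apply/negPn/negP => /(failing_edge pe pF')[s [t [sc tp est st' nst]]].
  have st := edge_neq e_irr est.
  have T : tie e psi F F' (HE u c) (HE s t) by split=> //; apply/andP.
  have us : u != s by apply: contraNneq uN => ->.
  have ut : u != t by apply: contraNneq uN => ->; rewrite inE tp orbT.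
  have nch b : b \in p -> e u b = false by move/(allP achord)/negbTE.
  case: (tie_EE e_sym e_irr exF T us ut) => -[E]; first by rewrite nch.
  rewrite nch //; move: sc; rewrite inE => /predU1P[sE|//].
  by rewrite sE E eqxx in st.
(* The equality of the two ends and the equalities along the rest of the walk force the one along
   its first edge. *)
case/negP: uc; apply: equal_on_trans ul _; rewrite equal_on_sym.
exact: equal_on_last.
Qed.

Variables (m : nat) (F : nat -> {vspace vT}).
Hypotheses (F0 : F 0%N = fullv)
  (Fm : forall h, in_cone e psi h -> (F m <= hsp h)%VS)
  (Fex : forall i, (i < m)%N -> exchange e psi (F i) (F i.+1)).

Lemma path_equal_on_m u p : path e u p -> path (equal_on (F m)) u p.
Proof. by apply: sub_path => s t est; apply: Fm. Qed.

(* [Q] plays the star of an apex attached to the vertices satisfying [N]; the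
   apex together with the walk is a chordless circuit. *)
Lemma no_apex_walk (Q : 'I_n -> @hyp n) (N : pred 'I_n) u p (w := last u p) :
  path e u p -> induced e u p -> ~~ e u w ->
  in_cone e psi (Q u) -> in_cone e psi (Q w) ->
  {in p, forall c, c != w -> ~~ N c} ->
  (forall x y, x u = x w ->
     (vec x y \in hsp (R := R) (Q u)) = (vec x y \in hsp (R := R) (Q w))) ->
  (forall x y, vec x y \in hsp (R := R) (Q u) ->
     vec x y \in hsp (R := R) (Q w) -> x u = x w) ->
  (forall (G G' : {vspace vT}) v s t, exchange e psi G G' ->
     s \in u :: p -> t \in u :: p ->
     tie e psi G G' (Q v) (HE s t) -> (s = v /\ N t) \/ (t = v /\ N s)) ->
  (forall G G' : {vspace vT}, exchange e psi G G' ->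
     tie e psi G G' (Q u) (Q w) -> e u w) ->
  ~~ (fullv <= hsp (R := R) (Q u))%VS -> False.
Proof.
move=> pe ip nuw Qu Qw nN Quw1 Quw2 tQE tQQ Qfull.
(* [ok i] says that [F i] lies in every hyperplane of the circuit. It fails at 0 and holds at [m],
   so it starts to hold at some [j.+1]. *)
pose ok i := [&& (F i <= hsp (Q u))%VS, (F i <= hsp (Q w))%VS
               & path (equal_on (F i)) u p].
have [||j [jm /and3P[Qu' Qw' p'] nok]] := @first_step ok m.
- by rewrite /ok F0 (negbTE Qfull).
- by rewrite /ok !Fm ?path_equal_on_m.
have exF := Fex jm; have uNp := induced_notin ip.
(* An edge of the walk cannot tie with [Q u] or [Q w]: by [tQE] and [nN] it would have to be the
   missing edge between [u] and [w], or contradict [induced]. *)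
have edge : ~~ path (equal_on (F j)) u p ->
    (F j <= hsp (Q u))%VS /\ (F j <= hsp (Q w))%VS.
  move=> /(failing_edge pe p')[s [t [sp tp est st' nst]]].
  have tp' : t \in u :: p by rewrite inE tp orbT.
  have neq := edge_neq e_irr est.
  have nNt : t != w -> ~~ N t by apply: nN.
  split; apply/negPn/negP => nQ.
    have [||[tE _]] := tQE _ _ u s t exF sp tp'; first by split=> //; apply/andP.
      move=> [sE Nt]; have [tw|/nNt] := eqVneq t w; last by rewrite Nt.
      by rewrite -tw -sE est in nuw.
    by rewrite -tE tp in uNp.
  have [||[tE Ns]] := tQE _ _ w s t exF sp tp'; first by split=> //; apply/andP.
    move=> [sE Nt]; have /nNt : t != w by rewrite -sE eq_sym.
    by rewrite Nt.
  move: sp; rewrite inE => /predU1P[sE|sp]; first by rewrite -sE -tE est in nuw.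
  by have := nN s sp; rewrite -tE neq Ns => /(_ isT).
have walk : path (equal_on (F j)) u p.
  apply/negPn/negP => np; have [qu qw] := edge np.
  case/negP: np; apply: (induced_walk_equal exF pe ip p').
  by apply/equal_onP => x y xF; apply: Quw2 (subvP qu _ xF) (subvP qw _ xF).
have /equal_onP uw := equal_on_last walk.
(* As the walk gives [x u = x w] on [F j], the two apex hyperplanes fail together; their tie makes
   [u] and [w] adjacent. *)
have QQ : (F j <= hsp (Q u))%VS = (F j <= hsp (Q w))%VS.
  by apply/vsub_vecP/vsub_vecP => h x y xF; have := h _ _ xF; rewrite Quw1 // (uw _ _ xF).
move: nok; rewrite /ok walk andbT QQ andbb => nQ.
by case/negP: nuw; apply: tQQ exF _; split; rewrite ?QQ //; apply/andP.
Qed.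

(** Chordality, stated for arbitrary walks and proved on an induced one inside; the apex is the
    vertex [x]. *)
Lemma no_chordless_cycle x u p : path e u p -> u != last u p ->
  ~~ e u (last u p) -> e x u -> e x (last u p) ->
  {in p, forall c, c != last u p -> (c != x) && ~~ e x c} -> False.
Proof.
move=> pe0 ul; move: (ul); have [p' [pe ip sp <-]] := induced_walk e_irr pe0 ul.
set w := last u p' => u_neq_w nuw xu xw hx.
have xNp : x \notin u :: p'.
  rewrite inE negb_or (edge_neq e_irr xu) /=; apply/negP => xp.
  by have := hx x (sp _ xp) (edge_neq e_irr xw); rewrite eqxx.
apply: (@no_apex_walk (HE x) (e x) u p') => //.
- by move=> c /sp /hx h /h /andP[].
- by move=> X y E; rewrite !mem_hspE E.
- by move=> X y; rewrite !mem_hspE => /eqP <- /eqP <-.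
- move=> G G' v s t exF su tu T; apply: (tie_EE e_sym e_irr exF T).
    by apply: contraNneq xNp => ->.
  by apply: contraNneq xNp => ->.
- move=> G G' exF T.
  have T' : tie e psi G G' (HE u x) (HE x w).
    by apply: tieC; apply: tieEr => //; apply: tieC.
  exact: (tie_EE_shared e_sym e_irr exF T' u_neq_w).
- apply/negP => /vsub_vecP/(_ (fun z => (z == x)%:R) 0 (memvf _)).
  by rewrite mem_hspE eqxx [u == x]eq_sym (negbTE (edge_neq e_irr xu)) oner_eq0.
Qed.

(** The hyperplanes of the label [a] act as the edges from an additional apex to the vertices
    carrying [a]. *)
Lemma common_label_convex a u p : path e u p -> u != last u p ->
  ~~ e u (last u p) -> a \in psi u -> a \in psi (last u p) ->
  {in p, forall c, c != last u p -> a \notin psi c} -> False.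
Proof.
move=> pe0 ul; move: (ul); have [p' [pe ip sp <-]] := induced_walk e_irr pe0 ul.
set w := last u p' => u_neq_w nuw au aw ha.
apply: (@no_apex_walk (HP^~ a) (fun v => a \in psi v) u p') => //.
- by move=> c /sp /ha.
- by move=> X y E; rewrite !mem_hspE E.
- by move=> X y; rewrite !mem_hspE => /eqP -> /eqP ->.
- by move=> G G' v s t exF su tu T; apply: (tie_PE e_irr exF T).
- by move=> G G' exF T; have [] := tie_PP e_sym e_irr exF T u_neq_w.
- apply/negP => /vsub_vecP/(_ (fun z => 1) 0 (memvf _)).
  by rewrite mem_hspE mulr0 oner_eq0.
Qed.

(** With [w] the end of the walk, the circuit is the walk together with [HY], [HP u a] and [HP w b]:
    equality along the walk gives [a y = b y], hence [y = 0]. *)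
Lemma no_label_valley a b u p : path e u p ->
  a \in psi u -> b \in psi (last u p) ->
  a \notin psi (last u p) -> b \notin psi u ->
  {in p, forall c, c != last u p -> (a \notin psi c) && (b \notin psi c)} -> False.
Proof.
move=> pe0 au bw aw bu hab.
have ul : u != last u p by apply: contraNneq aw => <-.
move: (ul) bw aw hab; have [p' [pe ip sp <-]] := induced_walk e_irr pe0 ul.
set w := last u p' => u_neq_w bw aw hab.
have ab : a != b by apply: contraNneq aw => ->.
have Na : {in p', forall c, a \notin psi c}.
  by move=> c /sp cp; have [->|/(hab c cp)/andP[]] := eqVneq c w.
have Nb : {in u :: p', forall c, b \in psi c -> c = w}.
  move=> c; rewrite inE => /predU1P[->|/sp cp bc]; first by rewrite (negbTE bu).
  by have [//|/(hab c cp)] := eqVneq c w; rewrite bc andbF.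
pose ok i := [&& (F i <= hsp HY)%VS, (F i <= hsp (HP u a))%VS,
    (F i <= hsp (HP w b))%VS & path (equal_on (F i)) u p'].
have [||j [jm /and4P[Y' Pu' Pw' p''] nok]] := @first_step ok m.
- rewrite /ok F0; apply/negP => /andP[/vsub_vecP/(_ (fun=> 1) 1 (memvf _))].
  by rewrite mem_hspE oner_eq0.
- by rewrite /ok !Fm ?path_equal_on_m.
have exF := Fex jm; have uNp := induced_notin ip.
have sub h : (F j <= hsp h)%VS -> forall x y, vec x y \in F j -> vec x y \in hsp h.
  by move/vsub_vecP.
(* An edge of the walk ties with none of the other three hyperplanes. If one fails, those three
   contain [F j], so both ends of the walk have coordinate 0 on it. *)
have walk : path (equal_on (F j)) u p'.
  apply/negPn/negP => np.
  have [s [t [sp' tp est st' nst]]] := failing_edge pe p'' np.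
  have tp' : t \in u :: p' by rewrite inE tp orbT.
  have neq := edge_neq e_irr est.
  case/negP: np; apply: (induced_walk_equal exF pe ip p'').
  have okY : (F j <= hsp HY)%VS.
    apply/negPn/negP => nY.
    have T : tie e psi (F j) (F j.+1) HY (HE s t) by split=> //; apply/andP.
    exact: (tie_YE e_irr exF T).
  have okPu : (F j <= hsp (HP u a))%VS.
    apply/negPn/negP => nP.
    have [|[sE]|[tE _]] := @tie_PE _ _ e psi e_irr _ _ exF u a s t.
    + by split=> //; apply/andP.
    + by rewrite (negbTE (Na _ tp)).
    + by rewrite -tE tp in uNp.
  have okPw : (F j <= hsp (HP w b))%VS.
    apply/negPn/negP => nP.
    have [|[sE /(Nb _ tp') tE]|[tE /(Nb _ sp') sE]] :=
      @tie_PE _ _ e psi e_irr _ _ exF w b s t.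
    + by split=> //; apply/andP.
    + by rewrite sE tE eqxx in neq.
    + by rewrite sE tE eqxx in neq.
  apply/equal_onP => x y xF; have := sub _ okY _ _ xF; have := sub _ okPu _ _ xF.
  have := sub _ okPw _ _ xF; rewrite !mem_hspE => /eqP -> /eqP -> /eqP ->.
  by rewrite !mulr0.
have /equal_onP uw := equal_on_last walk.
have PPY (c d : nat) : c != d ->
    (F j <= hsp (HP u c))%VS -> (F j <= hsp (HP w d))%VS -> (F j <= hsp HY)%VS.
  move=> cd Pc Pd; apply/vsub_vecP => x y xF; have := uw _ _ xF.
  have := sub _ Pc _ _ xF; have := sub _ Pd _ _ xF.
  rewrite !mem_hspE => /eqP -> /eqP -> /eqP.
  by rewrite -subr_eq0 -mulrBl mulf_eq0 subr_eq0 eqr_nat (negbTE cd).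
have YPP : (F j <= hsp HY)%VS -> (F j <= hsp (HP u a))%VS = (F j <= hsp (HP w b))%VS.
  move=> Yok; apply/vsub_vecP/vsub_vecP => h x y xF; have := h _ _ xF;
    have := sub _ Yok _ _ xF; rewrite !mem_hspE => /eqP ->; by rewrite !mulr0 (uw _ _ xF).
have PP : (F j <= hsp (HP u a))%VS || (F j <= hsp (HP w b))%VS.
  apply/negPn/negP; rewrite negb_or => /andP[nu nw].
  have [|_ abE] := @tie_PP _ _ e psi e_sym e_irr _ _ exF u a w b _ u_neq_w.
    by split=> //; apply/andP.
  by rewrite abE eqxx in ab.
(* If [y = 0] held on [F j], either label would imply the other and [ok j] would hold. *)
have nY : ~~ (F j <= hsp HY)%VS.
  apply/negP => Yok; move: nok; rewrite /ok Yok walk andbT /= YPP //.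
  by move: PP; rewrite YPP // orbb => ->.
(* Now [HY] ties with the one failing label, so another label [g] of the same vertex holds on [F j].
   It differs from the label holding at the other end, and [PPY] forces [y = 0]. *)
case/orP: PP => okP.
  have nP : ~~ (F j <= hsp (HP w b))%VS by apply: contra nY; apply: PPY okP.
  have [|g gw Pg] := @tie_YP _ _ e psi e_irr _ _ exF w b.
    by split=> //; apply/andP.
  by case/negP: nY; apply: PPY okP Pg; apply: contraNneq aw => ->.
have nP : ~~ (F j <= hsp (HP u a))%VS by apply: contra nY => Pu; apply: (PPY a b).
have [|g gw Pg] := @tie_YP _ _ e psi e_irr _ _ exF u a.
  by split=> //; apply/andP.
by case/negP: nY; apply: PPY Pg okP; apply: contraNneq bu => <-.
Qed.
End Obstructions.

(** * Weighted elimination orderings *)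

Section Elimination.
Set Implicit Arguments.
Unset Strict Implicit.
Context {T : finType} (e : rel T).
Hypothesis (e_sym : symmetric e) (e_irr : irreflexive e).
Implicit Types (W C D K : {set T}) (u v w c x z : T).

(** Connectivity is taken in the subgraph induced on [D], so that connecting walks stay inside the
    component. *)
Lemma component D z : z \in D -> exists C,
  [/\ z \in C, C \subset D,
      forall c u, c \in C -> e c u -> u \in D -> u \in C &
      {in C &, forall c c', exists q, [/\ path e c q, last c q = c'
                                       & {subset q <= C}]}].
Proof.
move=> zD; pose r := [rel a b | [&& e a b, a \in D & b \in D]].
have r_sym : symmetric r by move=> a b; rewrite /= e_sym [(a \in D) && _]andbC.
have c_sym := @sym_connect_sym _ r r_sym.
have rD a q : path r a q -> {subset q <= D}.
  elim: q a => //= b q IH a /andP[/and3P[_ _ bD] /IH sub] t.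
  by rewrite inE => /predU1P[->|/sub].
exists [set c | connect r z c]; split.
- by rewrite inE.
- apply/subsetP=> c; rewrite inE => /connectP[q pq ->].
  by have := mem_last z q; rewrite inE => /predU1P[->|/(rD _ _ pq)].
- move=> c u; rewrite !inE => zc ecu uD.
  apply: (connect_trans zc); apply: connect1; rewrite /= ecu uD andbT.
  case/connectP: zc => q pq ->.
  by have := mem_last z q; rewrite inE => /predU1P[->|/(rD _ _ pq)].
- move=> c c'; rewrite !inE => zc zc'.
  have /connectP[q pq ->] : connect r c c' by rewrite (connect_trans _ zc') // c_sym.
  exists q; split=> //; first by apply: sub_path pq => a b /and3P[].
  move=> b bq; rewrite inE; apply: connect_trans zc _.
  move: pq; have : b \in c :: q by rewrite inE bq orbT.
  case/splitPl=> q1 q2 lq; rewrite cat_path => /andP[p1 _].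
  by apply/connectP; exists q1.
Qed.

Definition border W C := [set u in W :\: C | [exists c in C, e c u]].

Definition simplicial_in W v := clique e [set u in W | e v u].

(** A vertex of [C] has all its neighbours in [W] inside [C] or its border. *)
Lemma simplicial_sub W C v : v \in C -> C \subset W ->
  simplicial_in (C :|: border W C) v -> simplicial_in W v.
Proof.
move=> vC CW simp u w.
have nb t : t \in [set u in W | e v u] -> t \in [set u in C :|: border W C | e v u].
  rewrite !inE => /andP[tW evt]; rewrite tW evt andbT.
  by case: (t \in C) => //=; apply/exists_inP; exists v.
by move=> /nb uN /nb wN; apply: simp.
Qed.

Lemma border_walk W C u w :
  {in C &, forall c c', exists q, [/\ path e c q, last c q = c'
                                   & {subset q <= C}]} ->
  u \in border W C -> w \in border W C ->
  exists p, [/\ path e u p, last u p = w & {in p, forall c, c != w -> c \in C}].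
Proof.
move=> conn; rewrite !inE => /andP[_ /exists_inP[c cC ecu]].
move=> /andP[_ /exists_inP[c' c'C ecw]].
have [q [pq lq sq]] := conn c c' cC c'C.
exists (c :: rcons q w); split; rewrite /= ?last_rcons //.
  by rewrite e_sym ecu rcons_path pq lq.
move=> b; rewrite inE mem_rcons inE => /or3P[/eqP->//|/eqP->|/sq//].
by rewrite eqxx.
Qed.

Hypothesis chordal : forall x u p, path e u p -> u != last u p ->
  ~~ e u (last u p) -> e x u -> e x (last u p) ->
  {in p, forall c, c != last u p -> (c != x) && ~~ e x c} -> False.

(** Dirac's argument, with a clique to avoid: avoiding the border of a component is what places the
    vertex in the component itself. *)
Lemma simplicial_outside_clique W K : K \proper W -> clique e K ->
  exists2 v, v \in W :\: K & simplicial_in W v.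
Proof.
have [N] := ubnP #|W|; elim: N W K => // N IH W K; rewrite ltnS => WN.
(* A vertex of [K] that is not adjacent to everything: recurse into a component
   of its non-neighbours, whose border is a clique. *)
have step K' x : K' \subset W -> clique e K' -> x \in K' ->
    ~~ [forall z in W, (z != x) ==> e x z] ->
    exists2 v, v \in W :\: K' & simplicial_in W v.
  move=> K'W cK' xK' /forall_inPn[z zW]; rewrite negb_imply => /andP[zx exz].
  have xW := subsetP K'W x xK'.
  pose D := [set c in W | (c != x) && ~~ e x c].
  have zD : z \in D by rewrite inE zW zx.
  have DW : D \subset W by apply/subsetP=> c; rewrite inE => /andP[].
  have [C [zC CD clos conn]] := component zD.
  have CW := subset_trans CD DW.
  (* A border vertex not adjacent to [x] would lie in [D], hence in the component [C]. *)
  have xborder u : u \in border W C -> e x u.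
    rewrite !inE => /andP[/andP[uC uW] /exists_inP[c cC ecu]].
    have := subsetP CD c cC; rewrite inE => /and3P[_ _ nxc].
    apply: contraNT uC => nxu; apply: (clos c u cC ecu).
    rewrite inE uW nxu andbT /=.
    by apply: contraNneq nxc => <-; rewrite e_sym.
  have [|||v] := IH (C :|: border W C) (border W C).
  - apply: leq_trans WN; apply: proper_card; apply/properP; split.
      by apply/subsetP=> c; rewrite !inE => /orP[/(subsetP CW)//|/andP[/andP[]]].
    exists x => //; rewrite inE negb_or; apply/andP; split.
      by apply/negP => /(subsetP CD); rewrite inE eqxx andbF.
    by apply/negP => /xborder; rewrite e_irr.
  - apply/properP; split; first exact: subsetUr.
    by exists z; rewrite !inE zC.
  - move=> u w uB wB uw; apply/negPn/negP => nuw.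
    have [p [pp lp Cp]] := border_walk conn uB wB; subst w.
    apply: (chordal pp uw nuw (xborder _ uB) (xborder _ wB)) => c cp cl.
    by have := subsetP CD c (Cp c cp cl); rewrite inE => /andP[].
  rewrite !inE => /andP[vB /orP[vC|//]] simp; last by rewrite simp in vB.
  exists v; last exact: simplicial_sub simp.
  (* Being in [D], [v] is distinct from [x] and not adjacent to it, so it is outside the clique of
     [x]. *)
  rewrite !inE (subsetP CW) // andbT; apply/negP => vK'.
  have := subsetP CD v vC; rewrite inE => /and3P[_ vx nxv].
  by rewrite cK' // eq_sym in nxv.
(* Dominating vertices may be deleted. *)
have drop K' : K' \subset W -> K' != set0 -> W :\: K' != set0 ->
    [forall x in K', forall z in W, (z != x) ==> e x z] ->
    exists2 v, v \in W :\: K' & simplicial_in W v.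
  move=> K'W K'n0 DN0 /forall_inP dom.
  have domE x u : x \in K' -> u \in W -> x != u -> e x u.
    move=> xK' uW xu; have /forall_inP/(_ u uW) := dom x xK'.
    by rewrite eq_sym xu.
  have [|||v] := IH (W :\: K') set0.
  - apply: leq_trans WN; apply: proper_card; rewrite properE subsetDl /=.
    have /set0Pn[x xK'] := K'n0; apply/subsetPn; exists x.
      exact: (subsetP K'W).
    by rewrite inE xK'.
  - by rewrite proper0.
  - by move=> u w; rewrite inE.
  rewrite setD0 => vW simp; exists v => // u w.
  rewrite !inE => /andP[uW evu] /andP[wW evw] uw.
  have [uK|uK] := boolP (u \in K'); first exact: domE.
  have [wK|wK] := boolP (w \in K'); first by rewrite e_sym domE // eq_sym.
  by apply: simp => //; rewrite !inE ?uK ?wK ?uW ?wW.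
have main K' : K' \subset W -> clique e K' -> K' != set0 -> W :\: K' != set0 ->
    exists2 v, v \in W :\: K' & simplicial_in W v.
  move=> K'W cK' K'n0 Dn0.
  have [dom|] := boolP [forall x in K', forall z in W, (z != x) ==> e x z].
    exact: drop.
  by case/forall_inPn=> x xK'; apply: step.
move=> /properP[KW [y yW yK]] cK; have [K0|Kn0] := eqVneq K set0; last first.
  by apply: main => //; apply/set0Pn; exists y; rewrite inE yK.
(* With an empty clique, avoid an arbitrary vertex [y] instead, unless [y] is the only vertex. *)
subst K; have [W1|Wy] := eqVneq (W :\ y) set0.
  exists y; first by rewrite setD0.
  move=> u w; rewrite !inE => /andP[uW eyu] _ _.
  have : u \in W :\ y.
    by rewrite !inE uW andbT; apply: contraTneq eyu => ->; rewrite e_irr.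
  by rewrite W1 inE.
have [||||v vW simp] := main [set y]; rewrite ?sub1set //.
- by move=> u w; rewrite !inE => /eqP-> /eqP->; rewrite eqxx.
- by apply/set0Pn; exists y; rewrite inE.
by exists v => //; move: vW; rewrite !inE => /andP[_ ->].
Qed.

(** * Label sets and the choice of the last vertex *)

Variable psi : T -> {fset nat}.

Hypothesis label_convex : forall a u p, path e u p -> u != last u p ->
  ~~ e u (last u p) -> a \in psi u -> a \in psi (last u p) ->
  {in p, forall c, c != last u p -> a \notin psi c} -> False.
Hypothesis label_valley : forall a b u p, path e u p ->
  a \in psi u -> b \in psi (last u p) ->
  a \notin psi (last u p) -> b \notin psi u ->
  {in p, forall c, c != last u p -> (a \notin psi c) && (b \notin psi c)} -> False.

(** A single edge is a walk without inner vertices, so [label_valley] applies to it. *)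
Lemma adjacent_comparable u v : e u v ->
  (psi u `<=` psi v)%fset || (psi v `<=` psi u)%fset.
Proof.
move=> euv; apply/negPn/negP; rewrite negb_or => /andP[].
move=> /fsubsetPn[a au av] /fsubsetPn[b bv bu].
apply: (@label_valley a b u [:: v]) => //=; first by rewrite euv.
by move=> c; rewrite inE => /eqP->; rewrite eqxx.
Qed.

Lemma weighted_simplicial W : W != set0 -> exists v,
  [/\ v \in W, simplicial_in W v
    & {in W, forall u, e v u -> (psi v `<=` psi u)%fset}].
Proof.
case/set0Pn=> v1 v1W.
(* Least cardinality makes [A] minimal for inclusion among the label sets in [W]. *)
have [v0 v0W minv0] := @arg_minnP _ v1 (mem W) (fun v => #|` psi v|) v1W.
set A := psi v0 in minv0.
have minA u : u \in W -> (psi u `<=` A)%fset -> psi u = A.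
  by move=> uW uA; apply/eqP; rewrite eqEfcard uA minv0.
pose D := [set c in W | psi c == A].
have v0D : v0 \in D by rewrite inE eqxx andbT.
have DW : D \subset W by apply/subsetP=> c; rewrite inE => /andP[].
have [C [v0C CD clos conn]] := component v0D.
have CW := subset_trans CD DW.
have psiC c : c \in C -> psi c = A.
  by move/(subsetP CD); rewrite inE => /andP[_ /eqP].
have borderA u : u \in border W C -> (A `<` psi u)%fset.
  rewrite !inE => /andP[/andP[uC uW] /exists_inP[c cC ecu]].
  have nA : psi u != A.
    by apply: contra uC => uA; apply: (clos c u cC ecu); rewrite inE uW.
  have := adjacent_comparable ecu; rewrite (psiC c cC) => /orP[Au|/(minA u uW)uA].
    by rewrite fproperEneq Au eq_sym nA.
  by rewrite uA eqxx in nA.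
have [||v] := @simplicial_outside_clique (C :|: border W C) (border W C).
- apply/properP; split; first exact: subsetUr.
  by exists v0; rewrite !inE v0C.
- move=> u w uB wB uw; apply/negPn/negP => nuw.
  have [p [pp lp Cp]] := border_walk conn uB wB; subst w.
  have := borderA _ uB; rewrite fproperE => /andP[_ /fsubsetPn[a au aA]].
  have := borderA _ wB; rewrite fproperE => /andP[_ /fsubsetPn[b bw bA]].
  have nC (x : nat) : x \notin A -> {in p, forall c, c != last u p -> x \notin psi c}.
    by move=> xA c cp cl; rewrite psiC // Cp.
  (* [a] and [b] lie outside [A], so no inner vertex of the walk carries them. If one of them is
     common to both ends, [label_convex] applies; otherwise [label_valley] does. *)
  have [aw|aw] := boolP (a \in psi (last u p)).
    exact: label_convex pp uw nuw au aw (nC a aA).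
  have [bu|bu] := boolP (b \in psi u).
    exact: label_convex pp uw nuw bu bw (nC b bA).
  apply: label_valley pp au bw aw bu _ => c cp cl.
  by rewrite (nC a aA c cp cl) (nC b bA c cp cl).
rewrite !inE => /andP[vB /orP[vC|]] simp; last by rewrite simp in vB.
exists v; split.
- exact: (subsetP CW).
- exact: simplicial_sub simp.
move=> u uW evu; rewrite (psiC v vC); have [uC|uC] := boolP (u \in C).
  by rewrite psiC.
apply: fproper_sub; apply: borderA; rewrite !inE uC uW /=.
by apply/exists_inP; exists v.
Qed.

(** Put the vertex of [weighted_simplicial] last and order the remaining ones by induction. *)
Lemma weighted_elimination_ordering W : exists t : seq T,
  [/\ uniq t, t =i W & forall x0 i, (i < size t)%N ->
      clique e [set v in take i t | e (nth x0 t i) v] /\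
      {in take i t, forall v, e v (nth x0 t i) ->
        (psi (nth x0 t i) `<=` psi v)%fset}].
Proof.
have [N] := ubnP #|W|; elim: N W => // N IH W; rewrite ltnS => WN.
have [->|Wn0] := eqVneq W set0; first by exists [::]; split=> // x; rewrite !inE.
have [v [vW simp psiv]] := weighted_simplicial Wn0.
have [|t [ut tW ht]] := IH (W :\ v).
  by apply: leq_trans WN; rewrite [ltnRHS](cardsD1 v) vW.
exists (rcons t v); split.
- by rewrite rcons_uniq ut tW !inE eqxx.
- move=> x; rewrite mem_rcons inE tW !inE.
  by have [->|] := eqVneq x v; rewrite ?vW.
move=> x0 i; rewrite size_rcons ltnS leq_eqVlt => /predU1P[->|it].
  rewrite nth_rcons ltnn eqxx -cats1 take_size_cat //; split.
    move=> a b; rewrite !inE !tW !inE => /andP[/andP[_ aW] ea] /andP[/andP[_ bW] eb].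
    by apply: simp; rewrite inE ?aW ?bW.
  move=> a; rewrite tW !inE => /andP[_ aW] ea; apply: psiv => //.
  by rewrite e_sym.
rewrite nth_rcons it -cats1 takel_cat; last exact: ltnW.
exact: ht.
Qed.
End Elimination.

(** * From the elimination ordering to a permutation of the vertices *)

Theorem theorem2 (R : realType) (n : nat) (e : rel 'I_n)
    (psi : 'I_n -> {fset nat})
    (e_sym : symmetric e) (e_irr : irreflexive e)
    (psi_pos : forall (v : 'I_n) (a : nat), a \in psi v -> (0 < a)%N)
    (ss : arrangement_supersolvable (psi_graphical R e psi)) :
  exists s : {perm 'I_n},
    (forall i : 'I_n,
       clique e [set v in [set s j | j : 'I_n & (j < i)%N] | e (s i) v])
    /\ (forall i j : 'I_n, (i < j)%N -> e (s i) (s j) ->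
         (psi (s j) `<=` psi (s i))%fset).
Proof.
have [m [F [F0 Fm Fex]]] := cone_flag ss.
have [t [ut tT ht]] := weighted_elimination_ordering e_sym e_irr
  (no_chordless_cycle e_sym e_irr F0 Fm Fex)
  (common_label_convex e_sym e_irr F0 Fm Fex)
  (no_label_valley e_sym e_irr F0 Fm Fex) [set: 'I_n].
have st : size t = n.
  by rewrite -(card_uniqP ut) (eq_card tT) cardsT card_ord.
(* The default [i] is never reached, as [t] has size [n]. *)
pose f (i : 'I_n) : 'I_n := nth i t i.
have fE x0 i : f i = nth x0 t i by apply: set_nth_default; rewrite st.
have f_inj : injective f.
  move=> i j; rewrite !(fE i) => /eqP; rewrite nth_uniq ?st // => /eqP.
  exact: val_inj.
have take_f (i j : 'I_n) : (j < i)%N -> f j \in take i t.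
  move=> ji; rewrite (fE i) -(nth_take i ji); apply: mem_nth.
  by rewrite size_take st ltn_ord.
exists (perm f_inj); split=> [i|i j ij].
  have it : (i < size t)%N by rewrite st.
  have [cl _] := ht i i it; move=> u w; rewrite !inE permE.
  case/andP=> /imsetP[a]; rewrite inE permE => ai -> ea.
  case/andP=> /imsetP[b]; rewrite inE permE => bi -> eb.
  by apply: cl; rewrite inE take_f //= -/(f i).
rewrite !permE => eij; have jt : (j < size t)%N by rewrite st.
by have [_ ] := ht j j jt; apply=> //; apply: take_f.
Qed.
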